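(* Let $G=(V,E)$ be a finite connected graph with $n$ vertices and maximal degree $\Delta$. Then $\mathcal{AC}(G) \leq 20\,\Delta\, n$.
   Context: Acquaintance time: Let $G=(V,E)$ be a finite connected graph. Initially one agent is placed on each vertex. At any moment, two agents located at the endpoints of a common edge become acquainted (in particular, agents on adjacent vertices at the start are acquainted). In each round one chooses a matching of $G$ (not necessarily maximal), and for every edge of the matching the two agents on its endpoints swap places; after each round, all pairs of agents on adjacent vertices become acquainted. A sequence of matchings after which every pair of agents has been acquainted is a strategy for acquaintance in $G$. The acquaintance time $\mathcal{AC}(G)$ is the minimal number of rounds in a strategy for acquaintance in $G$. *)

(* Defs.v *)
From mathcomp Require Import all_boot.
Set Implicit Arguments. Unset Strict Implicit. Unset Printing Implicit Defensive.

Definition simple_graph (T : finType) (e : rel T) : Prop :=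
  symmetric e /\ irreflexive e.

Definition connected_graph (T : finType) (e : rel T) : Prop :=
  forall x y : T, connect e x y.

Definition max_degree (T : finType) (e : rel T) : nat :=
  \max_(v : T) #|[set u | e v u]|.

(* A matching, encoded as an involution m of the vertices: each vertex is either
   unmatched (m v = v) or matched to the adjacent vertex m v. *)
Definition is_matching (T : finType) (e : rel T) (m : T -> T) : Prop :=
  forall v : T, m (m v) = v /\ (m v = v \/ e v (m v)).

(* Agents are named by their initial vertex. [position ms t a] is the vertex
   occupied by agent a after the first t rounds of the sequence of matchings ms
   (for each matched edge, the two agents swap places). *)
Fixpoint position (T : finType) (ms : seq (T -> T)) (t : nat) (a : T) : T :=
  match t with
  | 0 => a
  | t'.+1 => nth id ms t' (position ms t' a)
  end.

Definition acquaintance_strategy (T : finType) (e : rel T) (ms : seq (T -> T)) : Prop :=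
  (forall i, i < size ms -> is_matching e (nth id ms i)) /\
  forall a b : T, a != b ->
    exists t, t <= size ms /\ e (position ms t a) (position ms t b).

(* AC(G) <= k  iff some strategy uses at most k rounds (AC(G) is the minimum). *)
Definition AC_le (T : finType) (e : rel T) (k : nat) : Prop :=
  exists ms : seq (T -> T), acquaintance_strategy e ms /\ size ms <= k.

(* Main.v *)
Require Import Defs.
From mathcomp Require Import all_boot zify.

(** Tour a spanning tree so that consecutive vertices of the tour are the ends
    of a path with at most four vertices, every vertex lying on at most
    [Delta + 1] of these paths (this refines the classical fact that the cube
    of a connected graph has a Hamiltonian path). If consecutive vertices
    could be exchanged directly, [n] rounds of odd-even transposition would
    make every two agents cross. The ends of a short path are exchanged by
    three matchings, which conjugate the transposition of its middle edge. A
    path meets at most [4 * Delta] others, so a greedy colouring splits the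
    paths into [4 * Delta + 1] disjoint families, and a round of odd-even
    transposition costs [3 * (4 * Delta + 1)] matchings, at most [20 * Delta]. *)

Set Implicit Arguments.
Unset Strict Implicit.
Unset Printing Implicit Defensive.

Lemma greedy_colouring (I : eqType) (r : rel I) (D : nat) (l : seq I) :
  symmetric r -> irreflexive r -> {in l, forall i, count (r i) l <= D} ->
  exists2 c : I -> nat,
    forall i, c i <= D & {in l &, forall i j, r i j -> c i != c j}.
Proof.
move=> r_sym r_irr; elim: l => [|p l IH] deg; first by exists (fun=> 0).
have [|c c_le c_proper] := IH.
  move=> i il; apply: leq_trans (deg i _); last by rewrite inE il orbT.
  exact: leq_addl.
pose used := [seq c i | i <- l & r p i].
have [k k_le k_free] : exists2 k, k <= D & k \notin used.
  suff /allPn[k] : ~~ all (mem used) (iota 0 D.+1).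
    by rewrite mem_iota ltnS => k_le k_free; exists k.
  apply: contraL (deg p (mem_head p l)) => /allP used_all; rewrite -ltnNge.
  have := uniq_leq_size (iota_uniq 0 D.+1) used_all.
  rewrite size_iota size_map size_filter => /leq_trans -> //=.
  exact: leq_addl.
have k_new j : j \in l -> r p j -> c j != k.
  move=> jl rpj; apply: contraNneq k_free => <-.
  by rewrite map_f // mem_filter rpj.
exists (fun i => if i == p then k else c i) => [i|i j]; first by case: ifP.
rewrite !inE; case: eqP => [-> _|_ /= il]; case: eqP => [->|_ /= jl] //.
- by rewrite r_irr.
- by move=> rpj; rewrite eq_sym k_new.
- by move=> _; rewrite r_sym; apply: k_new.
- exact: c_proper.
Qed.

Section DisjointFamilies.

Variable T : finType.

Definition disjoint_family (I : eqType) (f : I -> seq T) (l : seq I) : Prop :=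
  {in l &, forall i j, i != j -> [disjoint f i & f j]}.

Lemma disjoint_family_sub (I : eqType) (f g : I -> seq T) (l : seq I) :
  (forall i, f i \subset g i) -> disjoint_family g l -> disjoint_family f l.
Proof.
move=> fg dg i j il jl ij.
exact: disjointW (fg i) (fg j) (dg i j il jl ij).
Qed.

Lemma disjoint_family_map (I J : eqType) (f : J -> seq T) (g : I -> J) l :
  disjoint_family (f \o g) l -> disjoint_family f (map g l).
Proof.
move=> dfg _ _ /mapP[i il ->] /mapP[j jl ->] ij.
by apply: dfg => //; apply: contraNneq ij => ->.
Qed.

Lemma disjoint_map (f : T -> T) (s1 s2 : seq T) :
  injective f -> [disjoint map f s1 & map f s2] = [disjoint s1 & s2].
Proof.
move=> f_inj; rewrite !disjoint_has has_map; congr (~~ _).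
by apply: eq_has => x /=; rewrite mem_map.
Qed.

Lemma count_intersecting (I : Type) (f : I -> seq T) (s : seq T) l k :
  {in s, forall v, count (fun i => v \in f i) l <= k} ->
  count (fun i => ~~ [disjoint s & f i]) l <= size s * k.
Proof.
move=> s_load.
apply: (@leq_trans (\sum_(v <- s) count (fun i => v \in f i) l)).
  elim: l {s_load} => [|i l IH] /=; first by rewrite big1.
  rewrite big_split leq_add //= disjoint_has negbK.
  by case: hasP => //= -[v vs vi]; rewrite (big_rem v vs) /= vi.
rewrite -sum1_size big_distrl /= big_seq [leqRHS]big_seq.
by apply: leq_sum => v /s_load; rewrite mul1n.
Qed.

End DisjointFamilies.

Section Acquaintance.

Variables (T : finType) (e : rel T).
Implicit Types (ms : seq (T -> T)) (f g m : T -> T) (E : seq (T * T)).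

Definition all_matchings ms : Prop :=
  forall i, i < size ms -> is_matching e (nth id ms i).

Definition final ms (a : T) : T := position ms (size ms) a.

Definition meet ms (a b : T) : Prop :=
  exists t, t <= size ms /\ e (position ms t a) (position ms t b).

Lemma all_matchings_cat ms1 ms2 :
  all_matchings ms1 -> all_matchings ms2 -> all_matchings (ms1 ++ ms2).
Proof.
move=> m1 m2 i; rewrite size_cat nth_cat => lti.
by case: ltnP => lti1; [apply: m1 | apply: m2; lia].
Qed.

Lemma position_catl ms1 ms2 t a :
  t <= size ms1 -> position (ms1 ++ ms2) t a = position ms1 t a.
Proof. by elim: t => //= t IH lt; rewrite IH 1?ltnW // nth_cat lt. Qed.

Lemma position_catr ms1 ms2 t a :
  position (ms1 ++ ms2) (size ms1 + t) a = position ms2 t (final ms1 a).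
Proof.
elim: t => [|t IH]; first by rewrite addn0 position_catl.
by rewrite addnS /= IH nth_cat ltnNge leq_addr addKn.
Qed.

Lemma final_cat ms1 ms2 a : final (ms1 ++ ms2) a = final ms2 (final ms1 a).
Proof. by rewrite {1}/final size_cat position_catr. Qed.

Lemma meet_catl ms1 ms2 a b : meet ms1 a b -> meet (ms1 ++ ms2) a b.
Proof.
case=> t [t_le et]; exists t; rewrite size_cat !position_catl //.
by split=> //; apply: leq_trans t_le (leq_addr _ _).
Qed.

Lemma meet_catr ms1 ms2 a b :
  meet ms2 (final ms1 a) (final ms1 b) -> meet (ms1 ++ ms2) a b.
Proof.
case=> t [t_le et]; exists (size ms1 + t).
by rewrite size_cat leq_add2l !position_catr.
Qed.

(** * Exchanging disjoint pairs of agents *)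

Definition ends (xy : T * T) : seq T := [:: xy.1; xy.2].

Definition endpoints E : seq T := flatten (map ends E).

Definition eq_or_adj (xy : T * T) : bool := (xy.1 == xy.2) || e xy.1 xy.2.

Definition transposes f E : Prop :=
  {in E, forall xy, f xy.1 = xy.2 /\ f xy.2 = xy.1} /\
  forall v, v \notin endpoints E -> f v = v.

Fixpoint swap_pairs E (v : T) : T :=
  if E is (x, y) :: E' then
    if v == x then y else if v == y then x else swap_pairs E' v
  else v.

Lemma ends_endpoints E xy : xy \in E -> {subset ends xy <= endpoints E}.
Proof. by move=> xyE v vxy; apply/flatten_mapP; exists xy. Qed.

Lemma transposes_swap_pairs E :
  disjoint_family ends E -> transposes (swap_pairs E) E.
Proof.
elim: E => [|[x y] E IH] dE; first by split.
have [|E_swap E_fix] := IH.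
  by move=> p q pE qE; apply: dE; rewrite inE ?pE ?qE orbT.
split=> [p|v]; last first.
  by rewrite /= !inE !negb_or => /and3P[/negbTE -> /negbTE -> /E_fix].
rewrite inE => /predU1P[-> /=|pE]; first by rewrite !eqxx; case: eqP.
have [->|pxy] := eqVneq p (x, y); first by rewrite /= !eqxx; case: eqP.
have /dE : p \in (x, y) :: E by rewrite inE pE orbT.
move=> /(_ _ (mem_head _ _) pxy); rewrite !disjoint_cons !inE !negb_or.
case/and3P=> /andP[/negbTE p1x /negbTE p1y] /andP[/negbTE p2x /negbTE p2y] _.
by rewrite /= p1x p1y p2x p2y; apply: E_swap.
Qed.

Lemma transposes_matching f E : symmetric e ->
  transposes f E -> {in E, forall xy, eq_or_adj xy} -> is_matching e f.
Proof.
move=> e_sym [f_swap f_fix] e_adj v.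
have [/flatten_mapP[xy xyE]|/f_fix fv] := boolP (v \in endpoints E); last first.
  by rewrite !fv; split; last left.
have [f1 f2] := f_swap xy xyE; have := e_adj xy xyE.
rewrite !inE => adj /orP[] /eqP ->; rewrite !(f1, f2);
  case/predU1P: adj => [->|exy]; split; auto.
by right; rewrite e_sym.
Qed.

Lemma transposes_comp f g E1 E2 : [disjoint endpoints E1 & endpoints E2] ->
  transposes f E1 -> transposes g E2 -> transposes (g \o f) (E1 ++ E2).
Proof.
move=> d12 [f_swap f_fix] [g_swap g_fix]; split=> [xy|v].
  have xy1 : xy.1 \in ends xy by rewrite !inE eqxx.
  have xy2 : xy.2 \in ends xy by rewrite !inE eqxx orbT.
  rewrite mem_cat /= => /orP[xyE|xyE]; have endE := ends_endpoints xyE.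
    by have [-> ->] := f_swap xy xyE; rewrite !g_fix ?(disjointFr d12) ?endE.
  by rewrite !f_fix ?(disjointFl d12) ?endE //; apply: g_swap.
rewrite /endpoints map_cat flatten_cat mem_cat negb_or => /andP[v1 v2].
by rewrite /= f_fix // g_fix.
Qed.

Lemma transposes_conj m f E : involutive m ->
  transposes f [seq (m xy.1, m xy.2) | xy <- E] -> transposes (m \o f \o m) E.
Proof.
move=> mK [f_swap f_fix]; split=> [xy xyE|v vE] /=.
  by have [/= -> ->] := f_swap _ (map_f _ xyE); rewrite !mK.
rewrite f_fix ?mK //; apply: contra vE => /flatten_mapP[_ /mapP[xy xyE ->]].
rewrite !inE !(inj_eq (inv_inj mK)) => vxy.
by apply: (ends_endpoints xyE); rewrite !inE.
Qed.

Definition exchanges ms E : Prop :=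
  [/\ all_matchings ms, transposes (final ms) E &
      {in E, forall xy, meet ms xy.1 xy.2}].

Lemma exchanges_nil : exchanges [::] [::].
Proof. by split. Qed.

Lemma eq_mem_exchanges ms E1 E2 :
  E1 =i E2 -> exchanges ms E1 -> exchanges ms E2.
Proof.
move=> E12 [am [ms_swap ms_fix] ms_meet]; split=> //.
- split=> [xy|v vE2]; first by rewrite -E12; apply: ms_swap.
  apply: ms_fix; apply: contra vE2 => /flatten_mapP[xy].
  by rewrite E12 => /ends_endpoints; apply.
- by move=> xy; rewrite -E12; apply: ms_meet.
Qed.

Lemma exchanges_cat ms1 ms2 E1 E2 : [disjoint endpoints E1 & endpoints E2] ->
  exchanges ms1 E1 -> exchanges ms2 E2 -> exchanges (ms1 ++ ms2) (E1 ++ E2).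
Proof.
move=> d12 [am1 tr1 meet1] [am2 tr2 meet2]; split.
- exact: all_matchings_cat.
- have [swap12 fix12] := transposes_comp d12 tr1 tr2.
  by split=> [xy /swap12|v /fix12]; rewrite !final_cat.
- move=> xy; rewrite mem_cat => /orP[/meet1|xyE]; first exact: meet_catl.
  have fix1 v : v \in ends xy -> final ms1 v = v.
    move=> vxy; apply: tr1.2.
    by rewrite (disjointFl d12) // (ends_endpoints xyE).
  by apply: meet_catr; rewrite !fix1 ?inE ?eqxx ?orbT //; apply: meet2.
Qed.

Hypothesis e_sym : symmetric e.

Lemma meet_sym ms a b : meet ms a b -> meet ms b a.
Proof. by case=> t [t_le et]; exists t; rewrite e_sym. Qed.

(* Bring the two agents of each pair next to each other by [m], swap them, and
   undo [m]. *)
Lemma conjugate_exchange m E : is_matching e m -> disjoint_family ends E ->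
  {in E, forall xy, e (m xy.1) (m xy.2)} ->
  exchanges [:: m; swap_pairs [seq (m xy.1, m xy.2) | xy <- E]; m] E.
Proof.
move=> m_matching dE m_adj; set mE := map _ E.
have mK : involutive m by move=> v; have [] := m_matching v.
have swap_mE : transposes (swap_pairs mE) mE.
  apply/transposes_swap_pairs/disjoint_family_map => xy zw xyE zwE ne.
  by have := dE xy zw xyE zwE ne; rewrite -(disjoint_map _ _ (inv_inj mK)).
split; last by move=> xy xyE; exists 1; split=> //; apply: m_adj.
- case=> [|[|[|i]]] //= _; apply: transposes_matching swap_mE _ => //.
  by move=> _ /mapP[xy xyE ->]; rewrite /eq_or_adj m_adj ?orbT.
- exact: transposes_conj.
Qed.

(** * Exchanging the ends of short paths *)

(* A link [((b, a), (c, d))] stands for the path [a b c d], in which [a = b] and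
   [c = d] are allowed: its hubs [b] and [c] are adjacent, and each of its tips
   [a] and [d] is equal or adjacent to the nearest hub. *)
Local Notation link := ((T * T) * (T * T))%type.
Implicit Types (p q : link) (L : seq link) (s : seq T).

Definition hubs p : T * T := (p.1.1, p.2.1).

Definition tips p : T * T := (p.1.2, p.2.2).

Definition vertices p : seq T := ends p.1 ++ ends p.2.

Definition is_link p : bool :=
  [&& eq_or_adj p.1, eq_or_adj p.2, e p.1.1 p.2.1
    & [disjoint ends p.1 & ends p.2]].

Definition arms L : seq (T * T) := unzip1 L ++ unzip2 L.

Lemma tips_vertices p : ends (tips p) \subset vertices p.
Proof.
by apply/subsetP => v; rewrite !inE => /orP[] ->; rewrite !orbT.
Qed.

Lemma disjoint_arms L : {in L, forall p, is_link p} ->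
  disjoint_family vertices L -> disjoint_family ends (arms L).
Proof.
move=> L_link L_disj x y.
have armsP z : z \in arms L -> exists2 p, p \in L & z = p.1 \/ z = p.2.
  by rewrite mem_cat => /orP[] /mapP[p pL ->]; exists p; auto.
move=> /armsP[p pL xp] /armsP[q qL yq] xy.
have [pq|npq] := eqVneq p q; last first.
  apply: disjointW (L_disj p q pL qL npq); apply/subsetP => v;
    rewrite mem_cat; [case: xp|case: yq] => -> ->; by rewrite ?orbT.
have /and4P[_ _ _ p_disj] := L_link p pL.
move: xy; rewrite -pq in yq; case: xp yq => -> [] -> //; rewrite ?eqxx //.
by rewrite disjoint_sym.
Qed.

Lemma disjoint_links_exchange L : {in L, forall p, is_link p} ->
  disjoint_family vertices L ->
  exists2 ms, size ms = 3 & exchanges ms (map tips L).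
Proof.
move=> L_link L_disj; set m := swap_pairs (arms L).
have m_arms : transposes m (arms L).
  exact/transposes_swap_pairs/disjoint_arms.
have m_tips p : p \in L -> (m (tips p).1, m (tips p).2) = hubs p.
  move=> pL; have [_ /= ->] : m p.1.1 = p.1.2 /\ m p.1.2 = p.1.1.
    by apply: m_arms.1; rewrite mem_cat map_f.
  have [_ /= -> //] : m p.2.1 = p.2.2 /\ m p.2.2 = p.2.1.
  by apply: m_arms.1; rewrite mem_cat map_f ?orbT.
exists [:: m; swap_pairs [seq (m xy.1, m xy.2) | xy <- map tips L]; m] => //.
apply: conjugate_exchange.
- apply: transposes_matching m_arms _ => // x.
  by rewrite mem_cat => /orP[] /mapP[p /L_link /and4P[adj1 adj2 _ _] ->].
- apply: disjoint_family_map; exact: disjoint_family_sub tips_vertices L_disj.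
- move=> _ /mapP[p pL ->]; have [-> ->] := m_tips p pL.
  by case/and4P: (L_link p pL).
Qed.

Definition conflict p q : bool :=
  (p != q) && ~~ [disjoint vertices p & vertices q].

Lemma conflict_sym : symmetric conflict.
Proof. by move=> p q; rewrite /conflict eq_sym disjoint_sym. Qed.

Lemma conflict_irr : irreflexive conflict.
Proof. by move=> p; rewrite /conflict eqxx. Qed.

Lemma coloured_links_exchange (c : link -> nat) (d : nat) L :
  {in L, forall p, is_link p} -> disjoint_family (ends \o tips) L ->
  {in L &, forall p q, conflict p q -> c p != c q} ->
  exists2 ms, size ms <= 3 * d & exchanges ms [seq tips p | p <- L & c p < d].
Proof.
move=> L_link L_disj c_proper; elim: d => [|d [ms1 size_ms1 ex1]].
  exists [::]; rewrite // (eq_filter (a2 := pred0)) // filter_pred0.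
  exact: exchanges_nil.
have [||ms2 size_ms2 ex2] := @disjoint_links_exchange [seq p <- L | c p == d].
- by move=> p; rewrite mem_filter => /andP[_ /L_link].
- move=> p q; rewrite !mem_filter => /andP[/eqP cp pL] /andP[/eqP cq qL] pq.
  apply: contraT => meets; have := c_proper p q pL qL.
  by rewrite /conflict pq meets cp cq eqxx => /(_ isT).
exists (ms1 ++ ms2); first by rewrite size_cat size_ms2; lia.
apply: eq_mem_exchanges (exchanges_cat _ ex1 ex2) => [xy|].
  rewrite -map_cat; apply: eq_mem_map => p.
  by rewrite mem_cat !mem_filter orbC -andb_orl -leq_eqVlt.
rewrite disjoint_has; apply/hasPn => v /flatten_mapP[_ /mapP[p p_d ->] vp].
apply/negP => /flatten_mapP[_ /mapP[q q_d ->] vq].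
move: p_d q_d; rewrite !mem_filter => /andP[cp pL] /andP[/eqP cq qL].
have pq : p != q by apply: contraTneq cp => ->; rewrite cq ltnn.
by have := disjointFr (L_disj p q pL qL pq) vp; rewrite /= vq.
Qed.

Definition load L v : nat := count (fun p => v \in vertices p) L.

Lemma count_conflict k p L : p \in L ->
  (forall v, load L v <= k.+1) -> count (conflict p) L <= 4 * k.
Proof.
move=> pL load_le; rewrite (eq_count (a2 := predI
  (fun q => ~~ [disjoint vertices p & vertices q]) (predC1 p))); last first.
  by move=> q; rewrite /conflict /= andbC eq_sym.
rewrite -count_filter -[4]/(size (vertices p)).
apply: count_intersecting => v vp; rewrite -ltnS; apply: leq_trans (load_le v).
rewrite /load count_filter !(permP (perm_to_rem pL)) /= eqxx andbF vp ltnS.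
by apply: sub_count => q /andP[].
Qed.

Lemma links_exchange k L :
  {in L, forall p, is_link p} -> disjoint_family (ends \o tips) L ->
  (forall v, load L v <= k.+1) ->
  exists2 ms, size ms <= 3 * (4 * k).+1 & exchanges ms (map tips L).
Proof.
move=> L_link L_disj load_le.
have [|c c_le c_proper] :=
    greedy_colouring conflict_sym conflict_irr (D := 4 * k) (l := L).
  by move=> p pL; apply: count_conflict.
have [ms size_ms ex] :=
  coloured_links_exchange (4 * k).+1 L_link L_disj c_proper.
exists ms => //; apply: eq_mem_exchanges ex => xy.
by rewrite (eq_filter (a2 := predT)) ?filter_predT // => p; rewrite ltnS c_le.
Qed.

(** * Odd-even transposition *)

(* Under odd-even transposition every agent goes back and forth along the
   indices [0, ..., n - 1], pausing for one round at either end. *)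
Definition bounce (n c : nat) : nat := minn (c %% n.*2) (n.*2.-1 - c %% n.*2).

Lemma ltn_bounce n c : 0 < n -> bounce n c < n.
Proof. by rewrite /bounce; lia. Qed.

Lemma bounce_even_surj n i : i < n -> exists2 c, ~~ odd c & bounce n c = i.
Proof.
move=> lt_in; have [oi|ei] := boolP (odd i).
  exists (n.*2.-1 - i); first by lia.
  by rewrite /bounce modn_small; lia.
by exists i; rewrite // /bounce modn_small; lia.
Qed.

Lemma bounceS n c : 0 < n ->
  [\/ bounce n c.+1 = (bounce n c).+1 /\ odd (bounce n c) = odd c,
      bounce n c = (bounce n c.+1).+1 /\ odd (bounce n c.+1) = odd c |
      bounce n c.+1 = bounce n c /\
      if odd (bounce n c) == odd c then (bounce n c).+1 = n
      else bounce n c = 0].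
Proof.
move=> n_gt0; have n2_gt0 : 0 < n.*2 by rewrite double_gt0.
have lt_w := ltn_pmod c n2_gt0.
have : odd (c %% n.*2) = odd c by rewrite odd_mod ?odd_double.
have : c.+1 %% n.*2 = if (c %% n.*2).+1 == n.*2 then 0 else (c %% n.*2).+1.
  rewrite -addn1 -modnDml addn1; case: eqP => [->|/eqP ne]; first exact: modnn.
  by rewrite modn_small // ltn_neqAle ne.
rewrite /bounce => ->; move: (c %% n.*2) lt_w => w lt_w <-.
case: eqP => [w_last|w_next]; first by apply: Or33; case: eqP; lia.
have [w_right|w_turn] := ltnP w.+1 n; first by apply: Or31; lia.
have [w_end|w_left] := ltnP w n; first by apply: Or33; case: eqP; lia.
by apply: Or32; lia.
Qed.

Definition crossing (n c d u : nat) : Prop :=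
  bounce n (d + u) = (bounce n (c + u)).+1 /\ odd (bounce n (c + u)) = odd u.

Lemma crossing_modn n c d u :
  (c + u) %% n.*2 + (d + u) %% n.*2 + 2 = n.*2 ->
  (c + u) %% n.*2 < (d + u) %% n.*2 -> odd ((c + u) %% n.*2) = odd u ->
  crossing n c d u.
Proof.
rewrite /crossing /bounce.
move: ((c + u) %% _) ((d + u) %% _) => w w' sum lt_w <-.
have -> : minn w (n.*2.-1 - w) = w by lia.
have -> : minn w' (n.*2.-1 - w') = n.*2.-1 - w' by lia.
by split=> //; lia.
Qed.

Lemma bounce_crossing n c d :
  ~~ odd c -> ~~ odd d -> bounce n c != bounce n d ->
  exists2 u, u < n & crossing n c d u \/ crossing n d c u.
Proof.
move=> even_c even_d ne; have n_gt0 : 0 < n.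
  by rewrite lt0n; apply: contraNneq ne => ->; rewrite /bounce !sub0n !minn0.
(* This makes [c + u] and [d + u] add up to [-2] modulo [2 * n]. *)
pose u := n.-1 - (c./2 + d./2) %% n.
have lt_r := ltn_pmod (c./2 + d./2) n_gt0.
exists u; first by rewrite /u; lia.
have odd_rem b : ~~ odd b -> odd ((b + u) %% n.*2) = odd u.
  by move=> even_b; rewrite odd_mod ?odd_double // oddD (negbTE even_b).
have n2_gt0 : 0 < n.*2 by rewrite double_gt0.
have lt_c := ltn_pmod (c + u) n2_gt0; have lt_d := ltn_pmod (d + u) n2_gt0.
have rem_ne : (c + u) %% n.*2 != (d + u) %% n.*2.
  by apply: contra ne; rewrite eqn_modDr /bounce => /eqP ->.
have rem_sum : (c + u) %% n.*2 + (d + u) %% n.*2 + 2 = n.*2.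
  have /dvdnP[k sum] : n.*2 %| (c + u) %% n.*2 + (d + u) %% n.*2 + 2.
    rewrite /dvdn -modnDml modnDm modnDml.
    have -> : c + u + (d + u) + 2 = ((c./2 + d./2) %/ n).+1 * n.*2.
      by have := divn_eq (c./2 + d./2) n; rewrite /u; nia.
    by rewrite modnMl.
  suff k1 : k = 1 by rewrite sum k1 mul1n.
  by case: k sum => [|[|k]]; nia.
case: (ltngtP ((c + u) %% n.*2) ((d + u) %% n.*2)) rem_ne => // lt_cd _.
- by left; apply: crossing_modn; rewrite ?odd_rem.
- by right; apply: crossing_modn; rewrite ?odd_rem // (addnC (_ %% _)).
Qed.

Section OddEven.

Variables (x0 : T) (s : seq T).

Definition parity_indices (b : bool) : seq nat :=
  [seq j <- iota 0 (size s).-1 | odd j == b].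

Definition consecutive (j : nat) : T * T := (nth x0 s j, nth x0 s j.+1).

Lemma mem_parity_indices b j :
  (j \in parity_indices b) = (j.+1 < size s) && (odd j == b).
Proof. by rewrite mem_filter mem_iota andbC; congr (_ && _); lia. Qed.

Hypothesis s_uniq : uniq s.

Lemma mem_ends_consecutive i j : i < size s -> j.+1 < size s ->
  (nth x0 s i \in ends (consecutive j)) = (i == j) || (i == j.+1).
Proof. by move=> lti ltj; rewrite !inE !nth_uniq // ltnW. Qed.

Lemma disjoint_parity_pairs b :
  disjoint_family (ends \o consecutive) (parity_indices b).
Proof.
move=> i j; rewrite !mem_parity_indices => /andP[lti oi] /andP[ltj oj] ij.
rewrite !disjoint_cons /= !mem_ends_consecutive ?(ltnW lti) // eq_disjoint0 //.
by lia.
Qed.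

Lemma final_bounce ms c : 0 < size s ->
  exchanges ms (map consecutive (parity_indices (odd c))) ->
  final ms (nth x0 s (bounce (size s) c)) = nth x0 s (bounce (size s) c.+1).
Proof.
move=> s_gt0 [_ [ms_swap ms_fix] _].
have swap j : j.+1 < size s -> odd j = odd c ->
    final ms (nth x0 s j) = nth x0 s j.+1 /\
    final ms (nth x0 s j.+1) = nth x0 s j.
  move=> ltj oj; have := ms_swap (consecutive j); apply.
  by rewrite map_f // mem_parity_indices ltj oj eqxx.
have lt1 := ltn_bounce c s_gt0; have lt2 := ltn_bounce c.+1 s_gt0.
case: (bounceS c s_gt0) => [[step oj]|[step oj]|[step fix_end]].
- by rewrite step (swap _ _ oj).1 -?step.
- by rewrite step (swap _ _ oj).2 -?step.
rewrite step ms_fix //; apply/flatten_mapP => -[_ /mapP[j j_idx ->]].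
move: j_idx; rewrite mem_parity_indices => /andP[ltj oj].
by rewrite mem_ends_consecutive //; case: eqP fix_end oj; lia.
Qed.

Variable round : bool -> seq (T -> T).
Hypothesis round_exchanges : forall b,
  exchanges (round b) (map consecutive (parity_indices b)).

Definition odd_even_rounds (t : nat) : seq (T -> T) :=
  flatten (mkseq (round \o odd) t).

Lemma odd_even_roundsS t :
  odd_even_rounds t.+1 = odd_even_rounds t ++ round (odd t).
Proof. by rewrite /odd_even_rounds mkseqS flatten_rcons. Qed.

Lemma size_odd_even_rounds K t :
  (forall b, size (round b) <= K) -> size (odd_even_rounds t) <= t * K.
Proof.
move=> round_le; elim: t => // t IH.
by rewrite odd_even_roundsS size_cat mulSnr leq_add.
Qed.

Lemma odd_even_rounds_matchings t : all_matchings (odd_even_rounds t).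
Proof.
elim: t => // t IH; rewrite odd_even_roundsS; apply: all_matchings_cat => //.
by have [] := round_exchanges (odd t).
Qed.

Lemma final_odd_even_rounds t c : 0 < size s -> ~~ odd c ->
  final (odd_even_rounds t) (nth x0 s (bounce (size s) c)) =
  nth x0 s (bounce (size s) (c + t)).
Proof.
move=> s_gt0 even_c; elim: t => [|t IH]; first by rewrite addn0.
rewrite odd_even_roundsS final_cat IH addnS final_bounce //.
by rewrite oddD (negbTE even_c).
Qed.

Lemma meet_odd_even_rounds t c d u : ~~ odd c -> ~~ odd d ->
  crossing (size s) c d u -> u < t ->
  meet (odd_even_rounds t) (nth x0 s (bounce (size s) c))
    (nth x0 s (bounce (size s) d)).
Proof.
move=> even_c even_d [next odd_next].
have s_gt0 : 0 < size s by case: posnP next => // ->; rewrite /bounce; lia.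
elim: t => // t IH; rewrite ltnS leq_eqVlt odd_even_roundsS.
case/predU1P=> [ut|/IH]; last exact: meet_catl.
apply: meet_catr; rewrite !final_odd_even_rounds // -ut next.
have [_ _ meet_consecutive] := round_exchanges (odd u).
apply: (meet_consecutive (consecutive (bounce (size s) (c + u)))).
rewrite map_f // mem_parity_indices odd_next eqxx andbT -next.
exact: ltn_bounce.
Qed.

Lemma odd_even_rounds_meet :
  {in s &, forall a b, a != b -> meet (odd_even_rounds (size s)) a b}.
Proof.
move=> a b /(nthP x0)[i lti <-] /(nthP x0)[j ltj <-] ij.
have [c even_c ci] := bounce_even_surj lti.
have [d even_d dj] := bounce_even_surj ltj.
have [|u ltu [cross|cross]] := bounce_crossing even_c even_d (n := size s).
- by apply: contraNneq ij; rewrite ci dj => ->.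
- by rewrite -ci -dj; apply: meet_odd_even_rounds cross ltu.
- by apply: meet_sym; rewrite -ci -dj; apply: meet_odd_even_rounds cross ltu.
Qed.

End OddEven.

(** * Chains of links *)

Definition chains L s : Prop :=
  exists x y, s = rcons [seq (tips p).1 | p <- L] x /\
              s = y :: [seq (tips p).2 | p <- L].

Lemma tips_nth_chains x0 p0 L s j : chains L s -> j < (size s).-1 ->
  tips (nth p0 L j) = consecutive x0 s j.
Proof.
case=> x [y [sx sy]]; rewrite {1}sy /= !size_map => ltj.
rewrite /consecutive {1}sx sy nth_rcons !size_map ltj /=.
by rewrite !(nth_map p0).
Qed.

Lemma parity_exchange (x0 : T) k L s b :
  uniq s -> {in L, forall p, is_link p} -> chains L s ->
  (forall v, load L v <= k.+1) ->
  exists2 ms, size ms <= 3 * (4 * k).+1 &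
    exchanges ms (map (consecutive x0 s) (parity_indices s b)).
Proof.
move=> s_uniq L_link sL load_le; pose p0 : link := ((x0, x0), (x0, x0)).
have size_L : size L = (size s).-1.
  by have [_ [y [_ ->]]] := sL; rewrite /= !size_map.
pose Lb := [seq nth p0 L j | j <- parity_indices s b].
have tips_Lb j : j \in parity_indices s b ->
    tips (nth p0 L j) = consecutive x0 s j.
  by rewrite mem_filter mem_iota => /andP[_ ltj]; apply: tips_nth_chains.
have Lb_sub : subseq Lb L.
  by rewrite -[X in subseq _ X](mkseq_nth p0) size_L map_subseq ?filter_subseq.
have [p||v|ms size_ms] := @links_exchange k Lb.
- by move=> /(mem_subseq Lb_sub) /L_link.
- move=> _ _ /mapP[i ib ->] /mapP[j jb ->] ne; rewrite /= !tips_Lb //.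
  apply: (disjoint_parity_pairs x0 s_uniq ib jb).
  by apply: contraNneq ne => ->.
- exact: leq_trans (leq_count_subseq _ Lb_sub) (load_le v).
have -> : map tips Lb = map (consecutive x0 s) (parity_indices s b).
  by rewrite -map_comp; apply/eq_in_map.
by exists ms.
Qed.

Lemma chain_strategy k L s : uniq s -> {in L, forall p, is_link p} ->
  chains L s -> (forall v, load L v <= k.+1) ->
  exists2 ms, size ms <= size s * (3 * (4 * k).+1) &
    all_matchings ms /\ {in s &, forall a b, a != b -> meet ms a b}.
Proof.
move=> s_uniq L_link sL load_le.
have [x0 _] := sL.
have round_ex b := parity_exchange x0 b s_uniq L_link sL load_le.
have [even_ms size_even ex_even] := round_ex false.
have [odd_ms size_odd ex_odd] := round_ex true.
pose round b := if b then odd_ms else even_ms.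
have ex_round b :
    exchanges (round b) (map (consecutive x0 s) (parity_indices s b)).
  by case: b.
exists (odd_even_rounds round (size s)).
  by apply: size_odd_even_rounds; case.
split; first exact: odd_even_rounds_matchings ex_round _.
exact: odd_even_rounds_meet ex_round.
Qed.

(** * Tours of spanning trees *)

(* [Graft A B] hangs the tree [B] below the root of [A] as a new child. *)
Inductive tree : Type := Leaf of T | Graft of tree & tree.
Implicit Types A B t : tree.

Fixpoint root t : T :=
  match t with Leaf x => x | Graft A _ => root A end.

(* Reversing the tour of [B] makes the whole tour end at [root B], which is
   adjacent to its starting point [root A]. *)
Fixpoint tour t : seq T :=
  match t with Leaf x => [:: x] | Graft A B => tour A ++ rev (tour B) end.

Definition tour_end t : T :=
  match t with Leaf x => x | Graft _ B => root B end.

Definition stub t : T * T := (root t, tour_end t).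

Definition rev_link p : link := (p.2, p.1).

Fixpoint links t : seq link :=
  match t with
  | Leaf _ => [::]
  | Graft A B => links A ++ (stub A, stub B) :: rev (map rev_link (links B))
  end.

Fixpoint tree_in_graph t : bool :=
  match t with
  | Leaf _ => true
  | Graft A B => [&& tree_in_graph A, tree_in_graph B & e (root A) (root B)]
  end.

Definition subtree t : bool := tree_in_graph t && uniq (tour t).

Lemma subtree_graft A B : subtree (Graft A B) =
  [&& subtree A, subtree B, e (root A) (root B) & [disjoint tour A & tour B]].
Proof.
rewrite /subtree /= cat_uniq rev_uniq has_rev -disjoint_has disjoint_sym.
case: (tree_in_graph A) (tree_in_graph B) (uniq (tour A)) => [] [] [] //=;
  by rewrite ?andbF // andbA andbC.
Qed.

Lemma root_tour t : root t \in tour t.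
Proof. by elim: t => [x|A IH B _] /=; rewrite ?inE // mem_cat IH. Qed.

Lemma neq_root t v : v \notin tour t -> (v == root t) = false.
Proof. by apply: contraNF => /eqP ->; apply: root_tour. Qed.

Lemma ends_stub_tour t : {subset ends (stub t) <= tour t}.
Proof.
by case: t => [x|A B] v; rewrite !inE /= ?mem_cat ?mem_rev ?inE;
  case/orP => /eqP ->; rewrite ?root_tour ?eqxx ?orbT.
Qed.

Lemma ends_stub_notin t v : v \notin tour t -> (v \in ends (stub t)) = false.
Proof. by apply: contraNF; apply: ends_stub_tour. Qed.

Lemma chains_links t : chains (links t) (tour t).
Proof.
exists (tour_end t), (root t).
elim: t => [x|A [startA finishA] B [startB finishB]] //=.
rewrite !map_cat /= !map_rev -!map_comp; split.
- by rewrite {1}finishB rev_cons rcons_cat /= -cat_rcons -startA.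
- by rewrite {1}startB rev_rcons -cat_cons -finishA.
Qed.

Lemma eq_or_adj_stub t : tree_in_graph t -> eq_or_adj (stub t).
Proof.
rewrite /eq_or_adj; case: t => [x|A B] /=; first by rewrite eqxx.
by case/and3P=> _ _ ->; rewrite orbT.
Qed.

Lemma is_link_rev_link p : is_link (rev_link p) = is_link p.
Proof. by rewrite /is_link /= (e_sym p.2.1 p.1.1) disjoint_sym andbCA. Qed.

Lemma is_link_links t : subtree t -> {in links t, forall p, is_link p}.
Proof.
elim: t => // A IHA B IHB; rewrite subtree_graft => /and4P[tA tB eAB dAB] p.
rewrite /= mem_cat inE mem_rev => /or3P[|/eqP->|/mapP[q qB ->]].
- exact: IHA.
- have /andP[gA _] := tA; have /andP[gB _] := tB.
  rewrite /is_link !eq_or_adj_stub //= eAB; apply: disjointW dAB; apply/subsetP;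
    exact: ends_stub_tour.
- by rewrite is_link_rev_link; apply: IHB.
Qed.

Lemma load_links_graft A B v : load (links (Graft A B)) v =
  load (links A) v + ((v \in ends (stub A)) || (v \in ends (stub B))) +
  load (links B) v.
Proof.
rewrite /load /= count_cat /= mem_cat addnA; congr (_ + _).
rewrite count_rev count_map; apply: eq_count => p /=.
by rewrite !mem_cat orbC.
Qed.

Lemma load_links_notin t v : v \notin tour t -> load (links t) v = 0.
Proof.
elim: t => // A IHA B IHB; rewrite /= mem_cat mem_rev negb_or => /andP[vA vB].
by rewrite load_links_graft IHA ?IHB // !ends_stub_notin.
Qed.

Lemma count_adj_gt0 t v : e v (root t) -> 0 < count (e v) (tour t).
Proof.
by move=> adj; rewrite -has_count; apply/hasP; exists (root t);
  rewrite ?root_tour.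
Qed.

(* The ends of the tour carry one link less, which pays for the link added there
   by [Graft]. *)
Lemma load_links_stub_bound t v : subtree t -> v \in tour t ->
  load (links t) v + (v \in ends (stub t)) <= (count (e v) (tour t)).+1.
Proof.
elim: t => [x _ _|A IHA B IHB]; first by case: (_ \in _).
rewrite subtree_graft => /and4P[tA tB eAB dAB].
have -> : (v \in ends (stub (Graft A B))) = (v == root A) || (v == root B).
  by rewrite !inE.
rewrite load_links_graft [tour _]/= mem_cat mem_rev count_cat count_rev.
have [vA _|vA /= vB] := boolP (v \in tour A).
- have vB : v \notin tour B by rewrite (disjointFr dAB vA).
  rewrite (load_links_notin vB) (ends_stub_notin vB) (neq_root vB).
  have := IHA tA vA; have [->|_] := eqVneq v (root A); last by move=> /=; lia.
  by rewrite inE eqxx /=; have := count_adj_gt0 eAB; lia.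
- rewrite (load_links_notin vA) (ends_stub_notin vA) (neq_root vA).
  have := IHB tB vB; have [->|_] := eqVneq v (root B); last by move=> /=; lia.
  by rewrite inE eqxx /=; rewrite e_sym in eAB; have := count_adj_gt0 eAB; lia.
Qed.

Lemma load_links_bound t v : subtree t -> load (links t) v <= #|e v|.+1.
Proof.
move=> t_sub; have [vt|/load_links_notin -> //] := boolP (v \in tour t).
apply: leq_trans (leq_addr _ _) (leq_trans (load_links_stub_bound t_sub vt) _).
rewrite ltnS -size_filter -(card_uniqP _); last first.
  by apply: filter_uniq; case/andP: t_sub.
by apply: subset_leq_card; apply/subsetP => u; rewrite mem_filter => /andP[].
Qed.

Lemma graft_neighbour t x y : tree_in_graph t -> x \in tour t -> e x y ->
  exists t', [/\ tree_in_graph t', root t' = root t &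
                 perm_eq (tour t') (y :: tour t)].
Proof.
elim: t => [z _|A IHA B IHB /= /and3P[gA gB eAB]].
  rewrite inE => /eqP <- exy; exists (Graft (Leaf x) (Leaf y)); split=> //=.
  by rewrite (perm_catC [:: x] [:: y]).
rewrite mem_cat mem_rev => /orP[xA|xB] exy.
  have [A' [gA' rA' pA']] := IHA gA xA exy.
  exists (Graft A' B); split=> //=; first by rewrite gA' gB rA'.
  by rewrite -cat_cons perm_cat2r.
have [B' [gB' rB' pB']] := IHB gB xB exy.
exists (Graft A B'); split=> //=; first by rewrite gA gB' rB'.
rewrite perm_sym -cat1s perm_catCA perm_cat2l perm_sym perm_rev.
by rewrite (perm_trans pB') // perm_cons perm_sym perm_rev.
Qed.

Lemma subtree_extend t x y : subtree t -> x \in tour t -> connect e x y ->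
  exists t', [/\ subtree t', {subset tour t <= tour t'} & y \in tour t'].
Proof.
move=> + + /connectP[p].
elim: p x t => [|z p IHp] x t t_sub xt /=.
  by move=> _ ->; exists t; split.
case/andP=> exz pz y_last; have [zt|zt] := boolP (z \in tour t).
  exact: IHp y_last.
have /andP[gt ut] := t_sub; have [t1 [gt1 _ pt1]] := graft_neighbour gt xt exz.
have [||t' [t'_sub t1_t' yt']] := IHp z t1 _ _ pz y_last.
- by rewrite /subtree gt1 (perm_uniq pt1) /= zt.
- by rewrite (perm_mem pt1) mem_head.
by exists t'; split=> // v vt; apply: t1_t'; rewrite (perm_mem pt1) inE vt orbT.
Qed.

Lemma spanning_tree : connected_graph e -> 0 < #|T| ->
  exists2 t, subtree t & tour t =i T.
Proof.
move=> conn /card_gt0P[x0 _].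
suff [t t_sub t_all] : exists2 t, subtree t & {subset enum T <= tour t}.
  by exists t => // v; rewrite t_all ?mem_enum.
elim: (enum T) => [|y vs [t t_sub vs_t]]; first by exists (Leaf x0).
have [t' [t'_sub tt' yt']] := subtree_extend t_sub (root_tour t) (conn _ y).
exists t' => // v; rewrite inE => /predU1P[-> //|/vs_t]; exact: tt'.
Qed.

End Acquaintance.

Lemma leq_max_degree (T : finType) (e : rel T) v : #|e v| <= max_degree e.
Proof. by rewrite -[#|e v|]cardsE; apply: leq_bigmax. Qed.

Lemma max_degree_gt0 (T : finType) (e : rel T) :
  connected_graph e -> 1 < #|T| -> 0 < max_degree e.
Proof.
move=> conn /card_gt1P[a [b [_ _ ab]]].
have /connectP[[|z p] /= path_ab b_last] := conn a b.
  by rewrite b_last eqxx in ab.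
apply: leq_trans (leq_max_degree e a); apply/card_gt0P; exists z.
by case/andP: path_ab.
Qed.

Theorem theorem2p1 (T : finType) (e : rel T) :
  simple_graph e -> connected_graph e ->
  AC_le e (20 * max_degree e * #|T|).
Proof.
move=> [e_sym _] conn.
have [T_le1|T_gt1] := leqP #|T| 1.
  exists [::]; split=> //; split=> // a b.
  by rewrite (fintype_le1P T_le1 a b) eqxx.
have [t t_sub tT] := spanning_tree conn (ltnW T_gt1).
have /andP[_ t_uniq] := t_sub.
have load_le v : load (links t) v <= (max_degree e).+1.
  apply: leq_trans (load_links_bound e_sym v t_sub) _.
  by rewrite ltnS leq_max_degree.
have [ms size_ms [ms_matchings ms_meet]] := chain_strategy e_sym t_uniq
  (is_link_links e_sym t_sub) (chains_links t) load_le.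
exists ms; split; first by split=> // a b; apply: ms_meet; rewrite tT.
have size_tour : size (tour t) = #|T|.
  by rewrite -(card_uniqP t_uniq); apply: eq_card.
apply: leq_trans size_ms _; rewrite size_tour mulnC leq_mul2r.
by have := max_degree_gt0 conn T_gt1; lia.
Qed.
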